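(* Let $d\ge2$. The sequence $R(n)$, $n\ge2$, of arrival times of complete records forms a Markov chain with state space $\{2,3,\dots\}\cup\{\infty\}$ and with the following transition probabilities: for $n\ge3$ and every integer $j\ge n-1$, $$ \Pr\left(R(n)=k\mid R(n-1)=j\right)= \begin{cases} k^{-d}, & \text{for } k=j+1,\\ k^{-d}\prod_{m=j+1}^{k-1}\left(1-m^{-d}\right), & \text{for } j+1<k<\infty,\\ \prod_{m=j+1}^{\infty}\left(1-m^{-d}\right), & \text{for } k=\infty>j. \end{cases} $$ The state $\infty$ is absorbing, that is, $\Pr(R(n)=\infty\mid R(n-1)=\infty)=1$ for $n\ge3$.
   Context: Let $d\ge2$ and let $\boldsymbol{X}_1,\boldsymbol{X}_2,\dots$ be independent copies of a random vector $\boldsymbol{X}$ in $\mathbb{R}^d$ with independent components whose univariate marginal distribution functions $F_1,\dots,F_d$ are continuous. $\boldsymbol{X}_m$ is a complete record if each of its components is a record, i.e. $\boldsymbol{X}_m>\max_{1\le i\le m-1}\boldsymbol{X}_i$ (strict inequality in every component, maximum taken componentwise); $\boldsymbol{X}_1$ is a complete record by definition. Let $I_m$ be the indicator of the event that $\boldsymbol{X}_m$ is a complete record. The arrival time of the $n$-th complete record is $R(1):=1$ and $R(n):=\inf\{m\in\mathbb{N}:\sum_{i=1}^m I_i=n\}$ for $n\ge2$, where $\inf\emptyset:=\infty$ (the case where there is no further complete record). *)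

(* Defs.v *)
From HB Require Import structures.
From mathcomp Require Import all_boot all_order all_algebra finmap.
From mathcomp Require Import all_classical all_reals all_analysis.

Set Implicit Arguments.
Unset Strict Implicit.
Unset Printing Implicit Defensive.

Import Order.TTheory GRing.Theory Num.Theory.
Import numFieldNormedType.Exports.

Local Open Scope classical_set_scope.
Local Open Scope ring_scope.

Section Probability.
Context {disp : measure_display} {T : measurableType disp} {R : realType}.
Variable P : probability T R.

(* Only meaningful when P B > 0; otherwise the value is 0 by totality of /. *)
Definition cond_prob (A B : set T) : R := fine (P (A `&` B)) / fine (P B).

(* Mutual independence of the subfamily of Y indexed by D: the product rule
   over every finite subset of D. *)
Definition mutually_independent {disp' : measure_display}
    {T' : measurableType disp'} {I : choiceType} (D : set I)
    (Y : I -> {RV P >-> T'}) : Prop :=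
  forall J : {fset I}, [set` J] `<=` D ->
  forall A : I -> set T', (forall i, i \in J -> measurable (A i)) ->
  P (\bigcap_(i in [set` J]) (Y i @^-1` A i)) =
  (\prod_(i <- J) P (Y i @^-1` A i))%E.

(* (Y n)_{n >= n0} is a Markov chain with countable state space S. Transition
   probabilities are allowed to depend on the time n. *)
Definition markov_chain {E : Type} (n0 : nat) (S : set E) (Y : nat -> T -> E)
    : Prop :=
  [/\ countable S,
      forall n w, (n0 <= n)%N -> S (Y n w),
      forall n s, (n0 <= n)%N -> S s -> measurable [set w | Y n w = s] &
      forall (n : nat) (s : nat -> E) (s' : E), (n0 <= n)%N -> S s' ->
        let past := [set w | forall i, (n0 <= i <= n)%N -> Y i w = s i] in
        (0 < P past)%E ->
        cond_prob [set w | Y n.+1 w = s'] past =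
        cond_prob [set w | Y n.+1 w = s'] [set w | Y n w = s n]].

End Probability.

Section RandomVector.
Context {disp : measure_display} {T : measurableType disp} {R : realType}.
Variable P : probability T R.
Context {d : nat}.

Definition component (X : {RV P >-> d.-tuple R}) (i : 'I_d) : T -> R :=
  fun w => tnth (X w) i.

Lemma measurable_component (X : {RV P >-> d.-tuple R}) (i : 'I_d) :
  measurable_fun [set: T] (component X i).
Proof.
exact: (measurableT_comp (measurable_tnth i) (measurable_funPT X)).
Qed.

HB.instance Definition _ (X : {RV P >-> d.-tuple R}) (i : 'I_d) :=
  isMeasurableFun.Build _ _ _ _ (component X i) (measurable_component X i).

Definition independent_components (X : {RV P >-> d.-tuple R}) : Prop :=
  mutually_independent [set: 'I_d]
    (fun i => component X i : {RV P >-> R}).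

Definition continuous_marginals (X : {RV P >-> d.-tuple R}) : Prop :=
  forall i : 'I_d, continuous (cdf (component X i : {RV P >-> R})).

End RandomVector.

(* The copies are X 1, X 2, ...; the term X 0 is never used. *)
Definition independent_copies {disp disp0 disp' : measure_display}
    {T : measurableType disp} {T0 : measurableType disp0}
    {T' : measurableType disp'} {R : realType}
    (P : probability T R) (P0 : probability T0 R)
    (X : nat -> {RV P >-> T'}) (X0 : {RV P0 >-> T'}) : Prop :=
  mutually_independent [set m | (0 < m)%N] X /\
  forall m, (0 < m)%N -> forall A : set T', measurable A ->
    distribution P (X m) A = distribution P0 X0 A.

Section CompleteRecords.
Context {T : Type} {R : realType} {d : nat}.
Variable X : nat -> T -> d.-tuple R.

(* Componentwise maximum of X 1, ..., X (m - 1), for m >= 2. *)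
Definition previous_max (m : nat) (w : T) (c : 'I_d) : R :=
  \big[Num.max/tnth (X 1 w) c]_(1 <= i < m) tnth (X i w) c.

Definition complete_record (m : nat) (w : T) : bool :=
  (m == 1)%N || [forall c, previous_max m w c < tnth (X m w) c].

Definition record_count (m : nat) (w : T) : nat :=
  (\sum_(1 <= i < m.+1) complete_record i w)%N.

(* ereal_inf set0 = +oo. *)
Definition arrival_time (n : nat) (w : T) : \bar R :=
  if n == 1%N then 1%E else
  ereal_inf [set m%:R%:E | m in [set m | (0 < m)%N /\ record_count m w = n]].

End CompleteRecords.

Definition arrival_states (R : realType) : set (\bar R) :=
  [set m%:R%:E | m in [set m | (2 <= m)%N]] `|` [set +oo%E].
Arguments arrival_states R : clear implicits.

(* Main.v *)
Require Import Defs.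
From mathcomp Require Import all_boot all_order all_algebra finmap.
From mathcomp Require Import all_classical all_reals all_analysis.
From mathcomp Require Import measurable_realfun ring lra zify.

Set Implicit Arguments.
Unset Strict Implicit.
Unset Printing Implicit Defensive.

Import Order.TTheory GRing.Theory Num.Theory.
Import numFieldNormedType.Exports.

Local Open Scope classical_set_scope.
Local Open Scope ring_scope.

(** The indicator of a complete record at time [m >= 2] has probability
    [m ^- d], and these indicators are independent.  Granting this, the rest is
    bookkeeping: [R(n) = j] is decided by the first [j] indicators, while
    [R(n+1)] is then the time of the first record after [j], which depends on
    the later indicators only.  So conditioning on [R(n) = j], or on any event
    decided by the first [j] indicators that implies it, gives the same
    transition probabilities, namely the stated products.

    Independence is proved by induction on time, with an invariant strong
    enough to pass from [N] to [N + 1].  An event [B] is called decoupled at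
    time [N] when it is independent, jointly, of the componentwise maximum
    [M_N] of the first [N] vectors and of the vectors after [N]; the law of
    [M_N] is then the product of the [F_c ^+ N].  If [B] is decoupled at [N],
    so is [B] intersected with the record at [N + 1], and the intersection
    costs exactly the factor [(N + 1) ^- d]: component by component, the
    maximum [M], with distribution function [F ^+ N], and the new entry [Z],
    with distribution function [F], are independent, and
    [Pr (M < Z <= x)] is the integral of [F ^+ N] against [F] up to [x], that
    is [F x ^+ N.+1 / N.+1].  The factor [F x ^+ N.+1] is the law of the new
    maximum, and the other factor is the probability of a record
    ([record_max_law], [vector_record_max_law], [decoupled_record]).  The
    complement of the record follows by subtraction, and hence every event
    decided by the first [N] indicators is decoupled
    ([decoupled_determined]).

    Carrying the future vectors inside the invariant, as rectangles only, makes
    the product rule for finite families sufficient.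
    The integral is also elementary: its increments over a short interval are
    squeezed between two values whose difference is quadratic in the increment
    of [F] ([telescoping_eq0]).

    Finally, conditioning is meaningful because the conditions have positive
    probability; for [R(n) = +oo] this uses [d >= 2], through
    [\prod_(2 <= m < N) (1 - m ^- 2) >= 1 / 2]. *)

(** * Integrating a power of a distribution function against itself *)

(** Both bounds of the integral of [t ^+ n] over [[u, v]] by the extreme values
    of the integrand. *)
Lemma sub_expr_bounds (R : realType) (n : nat) (u v : R) : 0 <= u -> u <= v ->
  u ^+ n * (v - u) <= (v ^+ n.+1 - u ^+ n.+1) / n.+1%:R <= v ^+ n * (v - u).
Proof.
move=> u0 uv; have v0 : 0 <= v := le_trans u0 uv.
have n0 : (0 : R) < n.+1%:R by rewrite ltr0n.
have d0 : 0 <= v - u by rewrite subr_ge0.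
have sumc (c : R) : c * n.+1%:R = \sum_(i < n.+1) c.
  by rewrite sumr_const card_ord mulr_natr.
have split_exp (c : R) (i : 'I_n.+1) : c ^+ n = c ^+ (n - i) * c ^+ i.
  by rewrite -exprD subnK// -ltnS.
have lower : u ^+ n * n.+1%:R <= \sum_(i < n.+1) v ^+ (n - i) * u ^+ i.
  rewrite sumc; apply: ler_sum => i _; rewrite (split_exp _ i).
  by apply: ler_wpM2r; [exact: exprn_ge0 | exact: lerXn2r].
have upper : \sum_(i < n.+1) v ^+ (n - i) * u ^+ i <= v ^+ n * n.+1%:R.
  rewrite sumc; apply: ler_sum => i _; rewrite (split_exp _ i).
  by apply: ler_wpM2l; [exact: exprn_ge0 | exact: lerXn2r].
rewrite subrXX ler_pdivlMr// ler_pdivrMr//= mulrAC [v ^+ n * _ * _]mulrAC.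
by rewrite (mulrC (v - u)) !ler_wpM2r.
Qed.

Lemma sub_expr_le (R : realType) (n : nat) (u v : R) : 0 <= u -> u <= v ->
  v <= 1 -> v ^+ n - u ^+ n <= n%:R * (v - u).
Proof.
move=> u0 uv v1; case: n => [|n]; first by rewrite !expr0 subrr mul0r.
have /andP[_] := @sub_expr_bounds R n u v u0 uv.
rewrite ler_pdivrMr ?ltr0n// => /le_trans; apply.
rewrite mulrC ler_wpM2l// ler_piMl ?subr_ge0//.
by rewrite exprn_ile1// (le_trans u0).
Qed.

(** Continuity enters only as the intermediate value property.  With the two
    infinite points added, every level in [[0, 1]] is attained, so quantiles
    exist without boundary cases. *)
Definition continuous_cdf (R : realType) (F : \bar R -> R) : Prop :=
  [/\ F -oo%E = 0, F +oo%E = 1, {homo F : s t / (s <= t)%E >-> s <= t} &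
      forall v, 0 <= v <= 1 -> exists s, F s = v].

Lemma continuous_cdf_ge0 (R : realType) (F : \bar R -> R) :
  continuous_cdf F -> forall t, 0 <= F t.
Proof. by move=> [F0 _ Fmono _] t; rewrite -F0; apply: Fmono; rewrite leNye. Qed.

Lemma continuous_cdf_le1 (R : realType) (F : \bar R -> R) :
  continuous_cdf F -> forall t, F t <= 1.
Proof. by move=> [_ F1 Fmono _] t; rewrite -F1; apply: Fmono; rewrite leey. Qed.

(** A function whose increments are quadratic in those of [F] is constant:
    cutting the range of [F] up to [F t] into [K] equal levels gives
    [|h t| <= K * C * (F t / K) ^+ 2], which tends to [0]. *)
Lemma telescoping_eq0 (R : realType) (F h : \bar R -> R) (C : R) :
  continuous_cdf F -> h -oo%E = 0 ->
  (forall s t, (s <= t)%E -> `|h t - h s| <= C * (F t - F s) ^+ 2) ->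
  forall t, h t = 0.
Proof.
move=> cF h0 hC t; have [F0 _ Fmono Fonto] := cF.
have hCs (s r : \bar R) : `|h r - h s| <= C * (F r - F s) ^+ 2.
  have [|/ltW] := leP s r; first exact: hC.
  by move=> /hC; rewrite distrC -(sqrrN (F r - F s)) opprB.
have F_ge0 := continuous_cdf_ge0 cF.
have chain (e : R) (K : nat) : 0 <= e ->
    forall r, F r = K%:R * e -> `|h r| <= K%:R * (C * e ^+ 2).
  move=> e0; elim: K => [|K IH] r Fr.
    by have := hCs -oo%E r; rewrite Fr F0 h0 !mul0r !subr0 expr0n/= mulr0.
  have [|s Fs] := Fonto (K%:R * e).
    rewrite mulr_ge0//= (le_trans _ (continuous_cdf_le1 cF r))// Fr.
    by rewrite ler_wpM2r// ler_nat.
  have {IH}hs := IH _ Fs; have hrs := hCs s r.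
  rewrite Fr Fs -mulrBl -natrB// subSnn mul1r in hrs.
  rewrite -[h r](subrK (h s)) (le_trans (ler_normD _ _))//.
  by rewrite -natr1 [X in _ <= X]mulrDl mul1r addrC lerD.
apply/eqP/negPn/negP => ht0.
have ht : 0 < `|h t| by rewrite normr_gt0.
(* Enough levels to make [K * C * (F t / K) ^+ 2] smaller than [|h t|]. *)
have [K K0 hK] : exists2 K : nat, (0 : R) < K%:R &
    C * F t ^+ 2 / `|h t| < K%:R.
  exists (Num.bound `|C * F t ^+ 2 / `|h t| |).+1; first by rewrite ltr0n.
  apply: (le_lt_trans (ler_norm _)); apply: lt_le_trans (archi_boundP (normr_ge0 _)) _.
  by rewrite ler_nat.
have := chain (F t / K%:R) K (divr_ge0 (F_ge0 t) (ltW K0)) t.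
rewrite mulrC divfK ?gt_eqF// => /(_ erefl); apply/negP; rewrite -ltNge.
rewrite (_ : _ * _ = C * F t ^+ 2 / K%:R); last by field; rewrite gt_eqF.
by rewrite ltr_pdivrMr// [_ * K%:R]mulrC -ltr_pdivrMr.
Qed.

(** * Probability of exceeding an independent maximum *)

Section EventProbability.
Context {disp : measure_display} {T : measurableType disp} {R : realType}.
Variable P : probability T R.

Definition pr (A : set T) : R := fine (P A).

Lemma prE (A : set T) : measurable A -> P A = (pr A)%:E.
Proof. by move=> mA; rewrite /pr fineK// fin_num_measure. Qed.

Lemma pr_ge0 (A : set T) : 0 <= pr A.
Proof. by rewrite /pr fine_ge0. Qed.

Lemma prT : pr setT = 1.
Proof. by rewrite /pr probability_setT. Qed.

Lemma pr0 : pr set0 = 0.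
Proof. by rewrite /pr measure0. Qed.

Lemma pr_le (A B : set T) : measurable A -> measurable B -> A `<=` B ->
  pr A <= pr B.
Proof.
move=> mA mB AB; rewrite /pr fine_le ?fin_num_measure//.
by apply: le_measure => //; rewrite inE.
Qed.

Lemma prU (A B : set T) : measurable A -> measurable B -> A `&` B = set0 ->
  pr (A `|` B) = pr A + pr B.
Proof.
by move=> mA mB AB; rewrite /pr measureU// fineD// fin_num_measure.
Qed.

Lemma prI_split (A B : set T) : measurable A -> measurable B ->
  pr A = pr (A `&` B) + pr (A `&` ~` B).
Proof.
move=> mA mB; rewrite -prU; [|exact: measurableI| |].
- by rewrite -setIUr setUv setIT.
- by apply: measurableI => //; exact: measurableC.
- by rewrite setIACA setICr setI0.
Qed.

Lemma measurable_le_event (f : T -> R) (y : \bar R) :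
  measurable_fun setT f -> measurable [set w | ((f w)%:E <= y)%E].
Proof.
move=> mf; rewrite -[X in measurable X]setTI.
by apply: emeasurable_fun_infty_c => //; exact/measurable_EFinP.
Qed.

Lemma measurable_gt_event (f : T -> R) (y : \bar R) :
  measurable_fun setT f -> measurable [set w | (y < (f w)%:E)%E].
Proof.
move=> mf; rewrite (_ : [set w | _] = ~` [set w | ((f w)%:E <= y)%E]).
  by apply: measurableC; exact: measurable_le_event.
by apply/seteqP; split => w /=; rewrite ltNge => /negP.
Qed.

Lemma measurable_itv_event (f : T -> R) (a b : \bar R) :
  measurable_fun setT f -> measurable [set w | (a < (f w)%:E <= b)%E].
Proof.
move=> mf; rewrite (_ : [set w | _] =
  [set w | (a < (f w)%:E)%E] `&` [set w | ((f w)%:E <= b)%E]).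
  by apply: measurableI; [exact: measurable_gt_event | exact: measurable_le_event].
by apply/seteqP; split => w /= /andP.
Qed.

Lemma measurable_lt_event (f g : T -> R) :
  measurable_fun setT f -> measurable_fun setT g ->
  measurable [set w | f w < g w].
Proof.
move=> mf mg; rewrite -[X in measurable X]setTI.
have mfg : measurable_fun setT (fun w => f w < g w) by exact: measurable_fun_ltr.
by apply: (mfg measurableT [set true]).
Qed.

(** Here [M] has distribution function [F ^+ N], the independent [Z] has
    distribution function [F], and [B] is independent of both, with [q] in
    place of its probability.  The increment between [s] and [t] of
    [Pr (B, M < Z <= x)] lies between [q * F s ^+ N * (F t - F s)] and
    [q * F t ^+ N * (F t - F s)], since [s < Z <= t] and [M <= s] imply
    [M < Z], which implies [M <= t].  The claimed value has the same bounds on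
    its increments, so the two agree by [telescoping_eq0]. *)
Lemma record_max_law (F : \bar R -> R) (N : nat) (q : R) (B : set T)
    (M Z : T -> R) :
  measurable B -> measurable_fun setT M -> measurable_fun setT Z ->
  0 <= q -> continuous_cdf F ->
  (forall y a b, (a <= b)%E ->
    pr (B `&` [set w | ((M w)%:E <= y)%E /\ (a < (Z w)%:E <= b)%E]) =
    q * (F y ^+ N * (F b - F a))) ->
  forall x, pr (B `&` [set w | M w < Z w /\ ((Z w)%:E <= x)%E]) =
    q * (F x ^+ N.+1 / N.+1%:R).
Proof.
move=> mB mM mZ q0 cF lawMZ; have [F0 _ Fmono _] := cF.
pose E x := B `&` [set w | M w < Z w /\ ((Z w)%:E <= x)%E].
have mE x : measurable (E x).
  apply: measurableI => //; apply: (measurableI [set w | M w < Z w]).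
    exact: measurable_lt_event.
  exact: measurable_le_event.
have mBox y a b : measurable
    (B `&` [set w | ((M w)%:E <= y)%E /\ (a < (Z w)%:E <= b)%E]).
  apply: measurableI => //; apply: (measurableI [set w | ((M w)%:E <= y)%E]).
    exact: measurable_le_event.
  exact: measurable_itv_event.
have increment s t : (s <= t)%E ->
    q * (F s ^+ N * (F t - F s)) <= pr (E t) - pr (E s) <=
    q * (F t ^+ N * (F t - F s)).
  move=> st.
  have mS := measurable_le_event s mZ.
  have -> : pr (E t) - pr (E s) = pr (E t `&` ~` [set w | ((Z w)%:E <= s)%E]).
    rewrite (prI_split (mE t) mS) addrAC (_ : E t `&` _ = E s) ?subrr ?add0r//.
    apply/seteqP; split => w /=; first by move=> [[? []]].
    by move=> [Bw [MZ Zs]]; do !split => //; exact: le_trans st.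
  rewrite -!lawMZ//; apply/andP; split; apply: pr_le => //.
  - by apply: measurableI => //; exact: measurableC.
  - move=> w /= [Bw [Ms /andP[sZ Zt]]]; do !split => //.
      by rewrite -lte_fin; exact: le_lt_trans sZ.
    by apply/negP; rewrite -ltNge.
  - by apply: measurableI => //; exact: measurableC.
  - move=> w /= [[Bw [MZ Zt]] /negP]; rewrite -ltNge => sZ; do !split => //.
      by rewrite (le_trans _ Zt)// lee_fin ltW.
    by rewrite sZ.
pose h t := pr (E t) - q * (F t ^+ N.+1 / N.+1%:R).
have F_ge0 := continuous_cdf_ge0 cF.
suff h0 : forall x, h x = 0 by move=> x; apply/eqP; rewrite -subr_eq0; exact/eqP/h0.
apply: (@telescoping_eq0 R F h (q * N%:R)) => //.
  rewrite /h F0 expr0n/= mul0r mulr0 subr0 (_ : E _ = set0) ?pr0//.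
  by apply/seteqP; split => // w /= [_ [_]]; rewrite leeNy_eq.
move=> s t st.
have /andP[l1 l2] := increment s t st.
have Fst := Fmono _ _ st.
have /andP[k1 k2] := @sub_expr_bounds R N _ _ (F_ge0 s) Fst.
have k3 := @sub_expr_le R N _ _ (F_ge0 s) Fst (continuous_cdf_le1 cF t).
have Fd : 0 <= F t - F s by rewrite subr_ge0.
have k4 : (F t ^+ N - F s ^+ N) * (F t - F s) <= N%:R * (F t - F s) ^+ 2.
  by rewrite expr2 mulrA ler_wpM2r.
have := ler_wpM2l q0 k1; have := ler_wpM2l q0 k2; have := ler_wpM2l q0 k4.
rewrite ler_norml /h; move: l1 l2; rewrite -(mulrA q).
rewrite [X in q * X <= q * _]mulrBl (mulrBl _ (F t ^+ N.+1)).
rewrite !(mulrBr q); move: (q * _) (q * _) (q * _) (q * _) (q * _) => a b c e f.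
by move=> *; apply/andP; split; lra.
Qed.

(** The one-dimensional law is applied to one component after another.  At
    stage [k] the components below [k] already carry the event [M < Z <= b],
    and the others still carry the product event [M <= y], [a < Z <= b]; all
    components but the current one are absorbed into the event [B]. *)
Lemma vector_record_max_law (d : nat) (F : 'I_d -> \bar R -> R) (N : nat)
    (q : R) (B : set T) (M Z : 'I_d -> T -> R) :
  measurable B -> (forall c, measurable_fun setT (M c)) ->
  (forall c, measurable_fun setT (Z c)) ->
  0 <= q -> (forall c, continuous_cdf (F c)) ->
  (forall y a b : 'I_d -> \bar R, (forall c, (a c <= b c)%E) ->
    pr (B `&` [set w | forall c,
      ((M c w)%:E <= y c)%E /\ (a c < (Z c w)%:E <= b c)%E]) =
    q * \prod_c (F c (y c) ^+ N * (F c (b c) - F c (a c)))) ->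
  forall x : 'I_d -> \bar R,
  pr (B `&` [set w | forall c, M c w < Z c w /\ ((Z c w)%:E <= x c)%E]) =
  q * \prod_c (F c (x c) ^+ N.+1 / N.+1%:R).
Proof.
move=> mB mM mZ q0 cF law x.
pose ev k (y a b : \bar R) (c : 'I_d) : set T := if (c < k)%N
  then [set w | M c w < Z c w /\ ((Z c w)%:E <= b)%E]
  else [set w | ((M c w)%:E <= y)%E /\ (a < (Z c w)%:E <= b)%E].
pose val k (y a b : \bar R) (c : 'I_d) : R := if (c < k)%N
  then F c b ^+ N.+1 / N.+1%:R else F c y ^+ N * (F c b - F c a).
have mev k y a b c : measurable (ev k y a b c).
  rewrite /ev; case: ifP => _.
    apply: (measurableI [set w | M c w < Z c w]).
      exact: measurable_lt_event.
    exact: measurable_le_event.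
  apply: (measurableI [set w | ((M c w)%:E <= y)%E]).
    exact: measurable_le_event.
  exact: measurable_itv_event.
have val_ge0 k y a b c : (a <= b)%E -> 0 <= val k y a b c.
  move=> ab; have Fge0 := continuous_cdf_ge0 (cF c); have [_ _ Fmono _] := cF c.
  rewrite /val; case: ifP => _; first by rewrite divr_ge0// exprn_ge0.
  by rewrite mulr_ge0 ?exprn_ge0// subr_ge0 Fmono.
suff all_k k : (k <= d)%N -> forall y a b : 'I_d -> \bar R,
    (forall c, (a c <= b c)%E) ->
    pr (B `&` \bigcap_c ev k (y c) (a c) (b c) c) =
    q * \prod_c val k (y c) (a c) (b c) c.
  have := all_k d (leqnn d) x (fun=> -oo%E) x (fun c => leNye (x c)).
  rewrite /val; under eq_bigr do rewrite ltn_ord; move=> <-; congr (pr (_ `&` _)).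
  apply/seteqP; split => w /= h c; first by rewrite /ev ltn_ord => _; exact: h.
  by have := h c I; rewrite /ev ltn_ord.
elim: k => [|k IH] kd y a b ab.
  have /= <- := law y a b ab; congr (pr (_ `&` _)).
  by apply/seteqP; split => w /= h c; [exact: h c I | move=> _; exact: h c].
pose c0 := Ordinal kd.
pose upd (f : 'I_d -> \bar R) v c := if c == c0 then v else f c.
have ev_other c y' a' b' : c != c0 -> ev k.+1 y' a' b' c = ev k y' a' b' c.
  by move=> cc0; rewrite /ev ltnS leq_eqVlt (negbTE (cc0 : (c != k :> nat))).
have val_other c y' a' b' : c != c0 -> val k.+1 y' a' b' c = val k y' a' b' c.
  by move=> cc0; rewrite /val ltnS leq_eqVlt (negbTE (cc0 : (c != k :> nat))).
pose B' := B `&` \bigcap_(c in [set c | c != c0]) ev k (y c) (a c) (b c) c.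
pose q' := q * \prod_(c | c != c0) val k (y c) (a c) (b c) c.
have mB' : measurable B'.
  by apply: measurableI => //; apply: fin_bigcap_measurable => //; exact: finite_finset.
have q'0 : 0 <= q' by apply: mulr_ge0 => //; apply: prodr_ge0 => c _; exact: val_ge0.
have law0 y' a' b' : (a' <= b')%E ->
    pr (B' `&` [set w | ((M c0 w)%:E <= y')%E /\ (a' < (Z c0 w)%:E <= b')%E]) =
    q' * (F c0 y' ^+ N * (F c0 b' - F c0 a')).
  move=> ab'; have := IH (ltnW kd) (upd y y') (upd a a') (upd b b').
  rewrite (bigD1 c0)//= {1}/val /upd !eqxx ltnn.
  under eq_bigr => c cc0 do rewrite (negbTE cc0).
  rewrite mulrCA mulrC => <-; last by move=> c; case: ifP.
  congr pr; apply/seteqP; split => w /=.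
    move=> [[Bw h] h0]; split => // c _; case: eqP => [->|/eqP cc0].
      by rewrite /ev ltnn.
    exact: h.
  move=> [Bw h]; have := h c0 I; rewrite eqxx /ev ltnn => h0; do !split => //.
  by move=> c cc0; have := h c I; rewrite (negbTE cc0).
have := record_max_law mB' (mM c0) (mZ c0) q'0 (cF c0) law0 (b c0).
rewrite (bigD1 c0)//= {1}/val ltnSn.
under eq_bigr => c cc0 do rewrite val_other//.
move=> law1; rewrite mulrCA [RHS]mulrC -/q' -law1; congr pr; apply/seteqP; split => w /=.
  move=> [Bw h]; have := h c0 I; rewrite /ev ltnSn => h0; do !split => //.
  by move=> c cc0; rewrite -ev_other//; exact: h.
move=> [[Bw h] h0]; split => // c _; have [->|cc0] := eqVneq c c0.
  by rewrite /ev ltnSn.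
by rewrite ev_other//; exact: h.
Qed.

End EventProbability.

(** * Law of a vector with independent components *)

Section RandomVectorLaw.
Context {disp : measure_display} {T : measurableType disp} {R : realType}.
Variable P : probability T R.
Context {d : nat}.
Variable X : {RV P >-> d.-tuple R}.

Definition rectangle (D : 'I_d -> set R) : set (d.-tuple R) :=
  [set t | forall c, D c (tnth t c)].

Lemma measurable_rectangle (D : 'I_d -> set R) :
  (forall c, measurable (D c)) -> measurable (rectangle D).
Proof.
move=> mD; rewrite (_ : rectangle D =
    \bigcap_(c in setT) ((fun t : d.-tuple R => tnth t c) @^-1` D c)).
  apply: fin_bigcap_measurable => [|c _]; first exact: finite_finset.
  rewrite -[X in measurable X]setTI; exact: measurable_tnth.
by apply/seteqP; split => t /= h c; [move=> _; exact: h | exact: h c I].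
Qed.

(** The finite family in the definition of independence is taken to be all of
    the index type. *)
Lemma pr_rectangle (D : 'I_d -> set R) : independent_components X ->
  (forall c, measurable (D c)) ->
  pr P (X @^-1` rectangle D) = \prod_c pr P (component X c @^-1` D c).
Proof.
move=> indep mD; pose J : {fset 'I_d} := [fset c in enum 'I_d]%fset.
have inJ c : c \in J by rewrite !inE mem_enum.
have JT : perm_eq J (index_enum 'I_d).
  apply: uniq_perm; [exact: fset_uniq | exact: index_enum_uniq |] => c.
  by rewrite inJ mem_index_enum.
have := indep J (fun _ _ => I) D (fun c _ => mD c).
rewrite (perm_big _ JT)/= => indepJ; rewrite {1}/pr.
rewrite (_ : X @^-1` _ = \bigcap_(c in [set` J]) (component X c @^-1` D c)).
  rewrite indepJ (eq_bigr (fun c => (pr P (component X c @^-1` D c))%:E)).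
    by rewrite prodEFin.
  by move=> c _; rewrite prE// -[X in measurable X]setTI; exact: measurable_component.
by apply/seteqP; split => w /= h c; [move=> _; exact: h | exact: h c (inJ c)].
Qed.

Definition marginal_cdf (c : 'I_d) (x : \bar R) : R :=
  pr P [set w | ((component X c w)%:E <= x)%E].

Lemma marginal_cdf_itv (c : 'I_d) (a b : \bar R) : (a <= b)%E ->
  pr P [set w | (a < (component X c w)%:E <= b)%E] =
  marginal_cdf c b - marginal_cdf c a.
Proof.
move=> ab; have mX := measurable_component X c.
have mle x := measurable_le_event x mX.
rewrite /marginal_cdf (prI_split P (mle b) (mle a)).
rewrite (_ : _ `&` [set w | _] = [set w | ((component X c w)%:E <= a)%E]).
  rewrite addrAC subrr add0r; congr pr; apply/seteqP; split => w /=.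
    by move=> /andP[aX Xb]; split => //; apply/negP; rewrite -ltNge.
  by move=> [Xb /negP]; rewrite -ltNge => aX; apply/andP.
apply/seteqP; split => w /=; first by case.
by move=> Xa; split => //; exact: le_trans ab.
Qed.

Lemma marginal_cdfE (c : 'I_d) (r : R) :
  cdf (component X c : {RV P >-> R}) r = (marginal_cdf c r%:E)%:E.
Proof.
rewrite /cdf /marginal_cdf -prE; last first.
  exact: measurable_le_event (measurable_component X c).
by rewrite /distribution /pushforward/=; congr (P _).
Qed.

(** The limits at both infinities bracket a level strictly between [0] and [1];
    the intermediate value theorem does the rest. *)
Lemma marginal_cdf_continuous (c : 'I_d) :
  continuous_marginals X -> continuous_cdf (marginal_cdf c).
Proof.
move=> contX; pose f (r : R) := marginal_cdf c r%:E.
have mle x := measurable_le_event x (measurable_component X c).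
have mono : {homo marginal_cdf c : s t / (s <= t)%E >-> s <= t}.
  by move=> s t st; apply: pr_le => // w /= h; exact: le_trans st.
have F0 : marginal_cdf c -oo%E = 0.
  rewrite -(pr0 P) /marginal_cdf; congr pr.
  by apply/seteqP; split => // w /=; rewrite leeNy_eq.
have F1 : marginal_cdf c +oo%E = 1.
  rewrite -(prT P) /marginal_cdf; congr pr.
  by apply/seteqP; split => // w _ /=; rewrite leey.
split => // v /andP[v0 v1].
have [->|vn0] := eqVneq v 0; first by exists -oo%E.
have [->|vn1] := eqVneq v 1; first by exists +oo%E.
have {}v0 : 0 < v by rewrite lt_def vn0.
have {}v1 : v < 1 by rewrite lt_neqAle vn1.
have fE : cdf (component X c : {RV P >-> R}) = EFin \o f.
  by apply/funext => r; rewrite marginal_cdfE.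
have cf : continuous f.
  by move=> r; have := contX c r; rewrite fE => /fine_cvg.
have [a fa] : exists a, f a < v.
  have := @cvg_cdfNy0 _ _ _ _ (component X c : {RV P >-> R}).
  rewrite fE => /fine_cvg /(_ _ (lt_nbhsl v0)) [a [_ ha]].
  by exists (a - 1); apply: ha; rewrite ltrBlDr ltrDl.
have [b fb] : exists b, v < f b.
  have := @cvg_cdfy1 _ _ _ _ (component X c : {RV P >-> R}).
  rewrite fE => /fine_cvg /(_ _ (lt_nbhsr v1)) [b [_ hb]].
  by exists (b + 1); apply: hb; rewrite ltrDl.
have ab : a <= b.
  rewrite leNgt; apply/negP => ba; have := lt_trans fa fb.
  by rewrite ltNge => /negP; apply; apply: mono; rewrite lee_fin ltW.
have [||r _ <-] := @IVT R f a b v ab; last by exists r%:E.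
  exact: continuous_subspaceT.
have fab : f a <= f b by rewrite ltW// (lt_trans fa).
by rewrite min_l// max_r// !ltW.
Qed.

End RandomVectorLaw.

(** * Records and arrival times along a fixed sequence *)

Section RunningMaximum.
Context {T : Type} {R : realType} {d : nat}.
Variable X : nat -> T -> d.-tuple R.

Lemma previous_max1 (w : T) (c : 'I_d) : previous_max X 1 w c = tnth (X 1 w) c.
Proof. by rewrite /previous_max big_geq. Qed.

Lemma previous_maxS (m : nat) (w : T) (c : 'I_d) : (0 < m)%N ->
  previous_max X m.+1 w c = Num.max (previous_max X m w c) (tnth (X m w) c).
Proof.
case: m => // m _; rewrite /previous_max /index_iota !subn1.
have -> : iota 1 m.+2.-1 = rcons (iota 1 m) m.+1.
  by rewrite -[m.+2.-1]addn1 iotaD add1n cats1.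
rewrite -[m.+1.-1]/m.
elim: (iota 1 m) => [|i s IH]; first by rewrite big_cons !big_nil maxC.
by rewrite rcons_cons !big_cons IH maxA.
Qed.

Lemma complete_recordS (N : nat) (w : T) : (0 < N)%N ->
  complete_record X N.+1 w =
  [forall c, previous_max X N.+1 w c < tnth (X N.+1 w) c].
Proof. by case: N. Qed.

End RunningMaximum.

Lemma natrE_inj (R : realType) (i k : nat) :
  i%:R%:E = k%:R%:E :> \bar R -> i = k.
Proof. by move=> /(congr1 fine) /= /eqP; rewrite eqr_nat => /eqP. Qed.

Section ArrivalTimes.
Context {T : Type} {R : realType} {d : nat}.
Variable X : nat -> T -> d.-tuple R.

Local Notation record := (complete_record X).
Local Notation count := (record_count X).
Local Notation arr := (arrival_time X).

Lemma record_count0 (w : T) : count 0 w = 0%N.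
Proof. by rewrite /record_count big_geq. Qed.

Lemma record_countS (m : nat) (w : T) :
  count m.+1 w = (count m w + record m.+1 w)%N.
Proof. by rewrite /record_count big_nat_recr. Qed.

Lemma record_count1 (w : T) : count 1 w = 1%N.
Proof. by rewrite record_countS record_count0. Qed.

Lemma leq_record_count (m m' : nat) (w : T) : (m <= m')%N ->
  (count m w <= count m' w)%N.
Proof.
move=> /subnKC <-; elim: (m' - m)%N => [|k IH]; first by rewrite addn0.
by rewrite addnS record_countS (leq_trans IH)// leq_addr.
Qed.

Lemma record_count_le (m : nat) (w : T) : (count m w <= m)%N.
Proof.
elim: m => [|m IH]; first by rewrite record_count0.
by rewrite record_countS -addn1 leq_add// leq_b1.
Qed.

(** The count increases by at most one at each step, so it visits every value,
    and reaches it for the first time at a record. *)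
Lemma record_count_reached (n k : nat) (w : T) :
  (0 < n)%N -> (n <= count k w)%N ->
  exists m, [/\ (0 < m <= k)%N, record m w & count m w = n].
Proof.
move=> n0; elim: k => [|k IH]; first by rewrite record_count0 leqNgt n0.
have [/IH[m [/andP[m0 mk] rm cm]] _|] := leqP n (count k w).
  by exists m; split => //; rewrite m0 leqW.
rewrite record_countS => ltn len; exists k.+1; rewrite record_countS.
by move: len; case: (record k.+1 w) => /= len; [split => //|]; lia.
Qed.

Lemma arrival_natP (n k : nat) (w : T) : (2 <= n)%N ->
  arr n w = k%:R%:E <-> [/\ (0 < k)%N, record k w & count k w = n].
Proof.
move=> n2; have n0 : (0 < n)%N by apply: leq_trans n2.
have arrE m : (0 < m)%N -> record m w -> count m w = n -> arr n w = m%:R%:E.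
  move=> m0 rm cm; rewrite /arrival_time gtn_eqF//.
  apply/eqP; rewrite eq_le; apply/andP; split.
    by apply: ereal_inf_lbound; exists m.
  apply: le_ereal_inf_tmp => _ [i [i0 ci] <-]; rewrite lee_fin ler_nat leqNgt.
  apply/negP => im; case: m m0 rm cm im => // m _ rm; rewrite record_countS rm.
  rewrite ltnS => cm im; have := leq_record_count w im; lia.
split=> [|[]]; last exact: arrE.
have [[m m0 cm]|none] := pselect (exists2 m, (0 < m)%N & count m w = n).
  have [|i [/andP[i0 _] ri ci]] := @record_count_reached n m w n0.
    by rewrite cm.
  rewrite (arrE i)// => /natrE_inj <-.
  by split.
rewrite /arrival_time gtn_eqF// (_ : [set _ | _ in _] = set0) ?ereal_inf0//.
apply/seteqP; split => // _ [m [m0 cm] <-]; apply: none.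
by exists m.
Qed.

Lemma arrival_cases (n : nat) (w : T) : (2 <= n)%N ->
  (arr n w = +oo%E /\ forall m, count m w <> n) \/
  exists k, [/\ arr n w = k%:R%:E, (n <= k)%N, record k w & count k w = n].
Proof.
move=> n2; have n0 : (0 < n)%N by apply: leq_trans n2.
have [[m cm]|none] := pselect (exists m, count m w = n); [right|left].
  have [|i [/andP[i0 _] ri ci]] := @record_count_reached n m w n0.
    by rewrite cm.
  exists i; split => //; first exact/arrival_natP.
  by rewrite -ci record_count_le.
split=> [|m cm]; last by apply: none; exists m.
rewrite /arrival_time gtn_eqF// (_ : [set _ | _ in _] = set0) ?ereal_inf0//.
apply/seteqP; split => // _ [m [m0 cm] <-]; apply: none.
by exists m.
Qed.

Lemma arrival_pinftyP (n : nat) (w : T) : (2 <= n)%N ->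
  arr n w = +oo%E <-> forall m, count m w <> n.
Proof.
move=> n2; split; have [[]//|[k [-> _ _ ck]]] := arrival_cases w n2 => //.
by move=> /(_ k).
Qed.

Lemma arrival_pinftyS (n : nat) (w : T) : (2 <= n)%N ->
  arr n w = +oo%E -> arr n.+1 w = +oo%E.
Proof.
move=> n2 /arrival_pinftyP none; apply/arrival_pinftyP => [|m cm]; first lia.
have [||i [_ _ ci]] := @record_count_reached n m w; first lia.
  by rewrite cm.
exact: none n2 _ ci.
Qed.

Definition no_record (j k : nat) : set T :=
  [set w | forall m, (j < m < k)%N -> ~~ record m w].

Lemma record_count_no_record (j k : nat) (w : T) : (j <= k)%N ->
  no_record j k.+1 w <-> count k w = count j w.
Proof.
move=> jk; split => [none|ck m /andP[jm mk]].
  suff const i : (i <= k - j)%N -> count (j + i) w = count j w.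
    by rewrite -(subnKC jk) const.
  elim: i => [|i IH] ik; first by rewrite addn0.
  rewrite addnS record_countS IH; last exact: ltnW.
  by have /negbTE -> := none (j + i).+1 ltac:(lia); rewrite addn0.
case: m jm mk => // m jm mk; apply/negP => rm.
have := leq_record_count w (mk : m.+1 <= k)%N.
have := leq_record_count w (jm : j <= m)%N.
by rewrite record_countS rm ck; lia.
Qed.

(** The time of record number [n + 1] is the first record after [j], as soon
    as [n] records are counted at time [j], whenever those occurred. *)
Lemma next_arrival_natP (n j k : nat) (w : T) : (0 < n)%N -> count j w = n ->
  arr n.+1 w = k%:R%:E <-> [/\ (j < k)%N, no_record j k w & record k w].
Proof.
move=> n0 cj; split.
  move=> /arrival_natP [//|k0 rk ck].
  have jk : (j < k)%N.
    by rewrite ltnNge; apply/negP => /(leq_record_count w); lia.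
  case: k k0 rk ck jk => // k _ rk; rewrite record_countS rk addn1 => -[ck] jk.
  by split => //; apply/record_count_no_record => //; rewrite ck cj.
move=> [jk none rk]; apply/arrival_natP => //; split => //; first lia.
case: k rk jk none => // k rk jk /record_count_no_record.
by rewrite record_countS rk => -> //; rewrite cj addn1.
Qed.

Lemma next_arrival_pinftyP (n j : nat) (w : T) : (0 < n)%N -> count j w = n ->
  arr n.+1 w = +oo%E <-> forall k, no_record j k w.
Proof.
move=> n0 cj; split.
  move=> /arrival_pinftyP none k m /andP[jm mk]; apply/negP => rm.
  have [||i [_ _ ci]] := @record_count_reached n.+1 m w => //.
    case: m jm rm mk => // m jm rm _; have := leq_record_count w (jm : j <= m)%N.
    by rewrite record_countS rm cj; lia.
  exact: none ci.
move=> none; apply/arrival_pinftyP => // m cm.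
have [mj|/ltnW jm] := leqP m j.
  by have := leq_record_count w mj; rewrite cm cj; lia.
by have /record_count_no_record := none m.+1; rewrite cm cj => /(_ jm); lia.
Qed.

(** Events of the sigma-algebra generated by the indicators up to time [N]. *)
Definition record_determined (N : nat) (B : set T) : Prop :=
  forall w w', (forall m, (0 < m <= N)%N -> record m w = record m w') ->
  B w -> B w'.

Lemma agree_record_count (N m : nat) (w w' : T) :
  (forall m, (0 < m <= N)%N -> record m w = record m w') -> (m <= N)%N ->
  count m w = count m w'.
Proof.
move=> agree; elim: m => [|m IH] mN; first by rewrite !record_count0.
by rewrite !record_countS IH ?(ltnW mN)// agree.
Qed.

Lemma record_determined_arrival (n k : nat) : (2 <= n)%N ->
  record_determined k [set w | arr n w = k%:R%:E].
Proof.
move=> n2 w w' agree /= /arrival_natP [//|k0 rk ck].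
apply/arrival_natP => //; split => //.
  by rewrite -agree// k0 leqnn.
by rewrite -(agree_record_count agree).
Qed.

(** On the event that record number [n] occurs at time [k], all earlier arrival
    times are at most [k], hence are decided by the indicators up to [k]. *)
Lemma record_determined_past (n k : nat) (s : nat -> \bar R) : (2 <= n)%N ->
  s n = k%:R%:E ->
  record_determined k
    [set w | forall i, (2 <= i <= n)%N -> arr i w = s i].
Proof.
move=> n2 sn w w' agree /= past i /andP[i2 iN].
have : arr n w = k%:R%:E by rewrite past ?n2/=.
move=> /arrival_natP [//|k0 rk ck].
have [||m [/andP[m0 mk] rm cm]] := @record_count_reached i k w; first lia.
  by rewrite ck.
rewrite -past ?i2//; have -> : arr i w = m%:R%:E by apply/arrival_natP.
apply/arrival_natP => //; split => //; first by rewrite -agree ?m0.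
by rewrite -(agree_record_count agree).
Qed.

End ArrivalTimes.

(** * Independence of the record indicators *)

Section CompleteRecordLaw.
Context {disp disp0 : measure_display} {R : realType} {d : nat}.
Context {T : measurableType disp} {T0 : measurableType disp0}.
Variables (P : probability T R) (P0 : probability T0 R).
Variables (X0 : {RV P0 >-> d.-tuple R}) (X : nat -> {RV P >-> d.-tuple R}).
Hypothesis indepX0 : independent_components X0.
Hypothesis contX0 : continuous_marginals X0.
Hypothesis copies : independent_copies X X0.

(** Only rectangles: their probabilities are given by the product rule. *)
Definition future_event (N : nat) (H : set T) : Prop :=
  exists (J : {fset nat}) (A : nat -> set (d.-tuple R)),
    [/\ forall i, i \in J -> (N < i)%N, forall i, measurable (A i) &
        H = \bigcap_(i in [set` J]) (X i @^-1` A i)].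

Lemma measurable_preimageX (i : nat) (A : set (d.-tuple R)) :
  measurable A -> measurable (X i @^-1` A).
Proof. by move=> mA; rewrite -[X in measurable X]setTI; exact: measurable_funPT. Qed.

Lemma measurable_future_event (N : nat) (H : set T) :
  future_event N H -> measurable H.
Proof.
move=> [J [A [_ mA ->]]]; apply: fin_bigcap_measurable => // i _.
exact: measurable_preimageX.
Qed.

Lemma future_eventT (N : nat) : future_event N setT.
Proof.
exists fset0, (fun=> setT); split => //.
by rewrite set_fset0 bigcap_set0.
Qed.

Lemma pr_copy (i : nat) (A : set (d.-tuple R)) : (0 < i)%N -> measurable A ->
  pr P (X i @^-1` A) = pr P0 (X0 @^-1` A).
Proof.
move=> i0 mA; have [_ /(_ i i0 A mA)] := copies.
by rewrite /distribution /pushforward /pr => ->.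
Qed.

(** Prepending a condition on the next vector yields again a future event, one
    step earlier; this is what lets the induction on time use the next vector
    without losing the later ones. *)
Lemma future_event_cons (N : nat) (A : set (d.-tuple R)) (H : set T) :
  measurable A -> future_event N.+1 H ->
  future_event N (X N.+1 @^-1` A `&` H) /\
  pr P (X N.+1 @^-1` A `&` H) = pr P0 (X0 @^-1` A) * pr P H.
Proof.
move=> mA [J [B [ltJ mB ->]]]; have [indep _] := copies.
have NJ : N.+1 \notin J by apply/negP => /ltJ; rewrite ltnn.
(* One family of target sets serves both conditions, as [N.+1] is not in [J]. *)
pose C i := if i == N.+1 then A else B i.
have mC i : measurable (C i) by rewrite /C; case: ifP.
have CB i : i \in J -> C i = B i.
  by rewrite /C; case: eqP => // -> NJ'; rewrite NJ' in NJ.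
have HE : \bigcap_(i in [set` J]) (X i @^-1` B i) =
          \bigcap_(i in [set` J]) (X i @^-1` C i).
  by apply: eq_bigcapr => i /= /CB ->.
have capE : X N.+1 @^-1` A `&` \bigcap_(i in [set` J]) (X i @^-1` B i) =
    \bigcap_(i in [set` (N.+1 |` J)%fset]) (X i @^-1` C i).
  by rewrite set_fsetU1 bigcap_setU1 -HE /C eqxx.
split.
  exists (N.+1 |` J)%fset, C; split => // i.
  by rewrite !inE => /orP[/eqP ->//|/ltJ]; exact: ltnW.
have JD : [set` J] `<=` [set m | (0 < m)%N] by move=> i /= /ltJ; exact: leq_trans.
rewrite capE /pr (indep _ _ C) => [|i /=|]//; last first.
  by rewrite !inE => /orP[/eqP ->//|/JD].
rewrite big_fsetU1// -(indep _ JD)// -HE /C eqxx fineM; last 2 first.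
- by rewrite fin_num_measure//; exact: measurable_preimageX.
- rewrite fin_num_measure//; apply: fin_bigcap_measurable => // i _.
  exact: measurable_preimageX.
by congr (_ * _); exact: pr_copy.
Qed.

Local Notation Xs := (fun m : nat => (X m : T -> d.-tuple R)).
Local Notation record m := [set w | complete_record Xs m w].

Definition max_below (N : nat) (x : 'I_d -> \bar R) : set T :=
  [set w | forall c, ((previous_max Xs N.+1 w c)%:E <= x c)%E].

(** The invariant of the induction on time.  The entries of [x] may be [+oo],
    which recovers the probability of [B] itself. *)
Definition decoupled (N : nat) (B : set T) : Prop :=
  measurable B /\ forall x H, future_event N H ->
    pr P (B `&` max_below N x `&` H) =
    pr P B * (\prod_c marginal_cdf X0 c (x c) ^+ N) * pr P H.

Lemma measurable_tnthX (m : nat) (c : 'I_d) :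
  measurable_fun setT (fun w => tnth (X m w) c).
Proof. exact: (measurable_component (X m) c). Qed.

Lemma measurable_previous_max (N : nat) (c : 'I_d) :
  measurable_fun setT (fun w => previous_max Xs N.+1 w c).
Proof.
elim: N => [|N IH].
  by under eq_fun do rewrite previous_max1; exact: measurable_tnthX.
under eq_fun do rewrite previous_maxS//.
exact: (measurable_maxr IH (measurable_tnthX _ c)).
Qed.

Lemma measurable_max_below (N : nat) (x : 'I_d -> \bar R) :
  measurable (max_below N x).
Proof.
rewrite (_ : max_below N x =
  \bigcap_c [set w | ((previous_max Xs N.+1 w c)%:E <= x c)%E]).
  apply: fin_bigcap_measurable => [|c _]; first exact: finite_finset.
  by apply: measurable_le_event; exact: measurable_previous_max.
by apply/seteqP; split => w /= h c; [move=> _; exact: h | exact: h c I].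
Qed.

Lemma measurable_record (N : nat) : (0 < N)%N -> measurable (record N.+1).
Proof.
move=> N0; rewrite (_ : record N.+1 = \bigcap_c
    [set w | previous_max Xs N.+1 w c < tnth (X N.+1 w) c]).
  apply: fin_bigcap_measurable => [|c _]; first exact: finite_finset.
  apply: measurable_lt_event; last exact: measurable_tnthX.
  exact: measurable_previous_max.
apply/seteqP; split => w /=; rewrite complete_recordS//.
  by move=> /forallP h c _; exact: h.
by move=> h; apply/forallP => c; exact: h.
Qed.

(** The maximum of a single vector is that vector. *)
Lemma decoupled_start : decoupled 1 setT.
Proof.
split=> // x H fH; rewrite setTI prT mul1r.
pose D c : set R := [set r | (r%:E <= x c)%E].
have mD c : measurable (D c) by exact: (measurable_le_event (f := id)).
have [_ prXH] := future_event_cons (measurable_rectangle mD) fH.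
under eq_bigr do rewrite expr1.
rewrite -(pr_rectangle indepX0 mD) -prXH; congr (pr P (_ `&` _)).
apply/seteqP; split => w /= h c; have := h c;
  by rewrite /D/= previous_maxS// previous_max1 maxxx.
Qed.

(** At a record time the new maximum is the new vector, so the event is
    [M_N < X_(N+1) <= x] in every component, and [vector_record_max_law]
    applies with [B] and the future as the independent event. *)
Lemma pr_record_max_below (N : nat) (B H : set T) (x : 'I_d -> \bar R) :
  (0 < N)%N -> decoupled N B -> future_event N.+1 H ->
  pr P (B `&` record N.+1 `&` max_below N.+1 x `&` H) =
  pr P B * (\prod_c (marginal_cdf X0 c (x c) ^+ N.+1 / N.+1%:R)) * pr P H.
Proof.
move=> N0 [mB decB] fH; have mH := measurable_future_event fH.
rewrite mulrAC -(@vector_record_max_law _ _ _ P d (marginal_cdf X0) N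
  (pr P B * pr P H) (B `&` H)
  (fun c w => previous_max Xs N.+1 w c) (fun c w => tnth (X N.+1 w) c)).
- congr pr; apply/seteqP; split => w /=.
    move=> [[[Bw]]]; rewrite complete_recordS// => /forallP rec maxx Hw.
    split => // c; split; first exact: rec.
    by have := maxx c; rewrite previous_maxS// (max_idPr (ltW (rec c))).
  move=> [[Bw Hw] h].
  have Rw : complete_record Xs N.+1 w.
    by rewrite complete_recordS//; apply/forallP => c; have [] := h c.
  split => //; split => // c; have [rec Zx] := h c.
  by rewrite previous_maxS// (max_idPr (ltW rec)).
- exact: measurableI.
- by move=> c; exact: measurable_previous_max.
- by move=> c; exact: measurable_tnthX.
- by rewrite mulr_ge0 ?pr_ge0.
- by move=> c; exact: marginal_cdf_continuous.
move=> y a b ab; pose D c : set R := [set r | (a c < r%:E <= b c)%E].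
have mD c : measurable (D c) by exact: (measurable_itv_event (f := id)).
have [fXH prXH] := future_event_cons (measurable_rectangle mD) fH.
transitivity (pr P (B `&` max_below N y `&` (X N.+1 @^-1` rectangle D `&` H))).
  congr pr; apply/seteqP; split => w /=.
    by move=> [[Bw Hw] h]; split; split => // c; have [] := h c.
  by move=> [[Bw My] [Zab Hw]]; split => // c; split; [exact: My | exact: Zab].
have prD : \prod_c pr P0 (component X0 c @^-1` D c) =
    \prod_c (marginal_cdf X0 c (b c) - marginal_cdf X0 c (a c)).
  by apply: eq_bigr => c _; rewrite -marginal_cdf_itv.
rewrite decB// prXH pr_rectangle// prD big_split/=.
by ring.
Qed.

Lemma max_belowT (N : nat) : max_below N (fun=> +oo%E) = setT.
Proof. by apply/seteqP; split => // w _ c; rewrite leey. Qed.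

Lemma prod_cdfT (N : nat) :
  \prod_c marginal_cdf X0 c +oo%E ^+ N = 1.
Proof.
rewrite big1// => c _; have [_ -> _ _] := marginal_cdf_continuous c contX0.
by rewrite expr1n.
Qed.

Lemma decoupled_record (N : nat) (B : set T) : (0 < N)%N -> decoupled N B ->
  decoupled N.+1 (B `&` record N.+1) /\
  pr P (B `&` record N.+1) = pr P B * N.+1%:R ^- d.
Proof.
move=> N0 decB; have [mB _] := decB.
have prod_rec (x : 'I_d -> \bar R) :
    \prod_c (marginal_cdf X0 c (x c) ^+ N.+1 / N.+1%:R) =
    N.+1%:R ^- d * \prod_c marginal_cdf X0 c (x c) ^+ N.+1.
  by rewrite big_split/= prodr_const card_ord exprVn mulrC.
have prBI : pr P (B `&` record N.+1) = pr P B * N.+1%:R ^- d.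
  have := pr_record_max_below (fun=> +oo%E) N0 decB (future_eventT N.+1).
  by rewrite max_belowT !setIT prT mulr1 prod_rec prod_cdfT mulr1.
split=> //; split; first exact/measurableI/measurable_record.
by move=> x H fH; rewrite pr_record_max_below// prBI prod_rec !mulrA.
Qed.

(** The condition [M_(N+1) <= x] splits into [M_N <= x] and [X_(N+1) <= x], and
    the latter is a condition on the future at time [N]. *)
Lemma decoupled_weaken (N : nat) (B : set T) : (0 < N)%N -> decoupled N B ->
  decoupled N.+1 B.
Proof.
move=> N0 [mB decB]; split => // x H fH.
pose D c : set R := [set r | (r%:E <= x c)%E].
have mD c : measurable (D c) by exact: (measurable_le_event (f := id)).
have [fXH prXH] := future_event_cons (measurable_rectangle mD) fH.
transitivity (pr P (B `&` max_below N x `&` (X N.+1 @^-1` rectangle D `&` H))).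
  congr pr; apply/seteqP; split => w /=.
    move=> [[Bw Mx] Hw]; split; split => // c; have := Mx c;
      by rewrite /D/= previous_maxS// EFin_max ge_max => /andP[].
  move=> [[Bw Mx] [Zx Hw]]; split => //; split => // c.
  by rewrite previous_maxS// EFin_max ge_max; apply/andP; split; [exact: Mx | exact: Zx].
rewrite decB// prXH pr_rectangle// mulrA -[_ * _ * \prod_c _]mulrA; congr (_ * _ * _).
by rewrite -big_split/=; apply: eq_bigr => c _; rewrite exprSr.
Qed.

Lemma decoupled_no_record (N : nat) (B : set T) : (0 < N)%N -> decoupled N B ->
  decoupled N.+1 (B `&` ~` record N.+1) /\
  pr P (B `&` ~` record N.+1) = pr P B * (1 - N.+1%:R ^- d).
Proof.
move=> N0 decB; have [mB _] := decB; have mI := measurable_record N0.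
have [[_ decBI] prBI] := decoupled_record N0 decB.
have [_ decB'] := decoupled_weaken N0 decB.
have prBnI : pr P (B `&` ~` record N.+1) = pr P B * (1 - N.+1%:R ^- d).
  by rewrite mulrBr mulr1 -prBI (prI_split P mB mI) addrAC subrr add0r.
split=> //; split; first by apply: measurableI => //; exact: measurableC.
move=> x H fH; have mE : measurable (B `&` max_below N.+1 x `&` H).
  apply: measurableI; last exact: measurable_future_event fH.
  by apply: measurableI => //; exact: measurable_max_below.
have := prI_split P mE mI; rewrite decB'//.
rewrite (_ : B `&` _ `&` H `&` record N.+1 =
    B `&` record N.+1 `&` max_below N.+1 x `&` H); last first.
  by apply/seteqP; split => w /=; tauto.
rewrite (_ : B `&` _ `&` H `&` ~` record N.+1 =
    B `&` ~` record N.+1 `&` max_below N.+1 x `&` H); last first.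
  by apply/seteqP; split => w /=; tauto.
rewrite decBI// prBI prBnI addrC => /eqP; rewrite -subr_eq => /eqP <-.
by ring.
Qed.

Lemma decoupled0 (N : nat) : decoupled N set0.
Proof. by split => // x H _; rewrite !set0I pr0 !mul0r. Qed.

Lemma decoupledU (N : nat) (A B : set T) : A `&` B = set0 ->
  decoupled N A -> decoupled N B -> decoupled N (A `|` B).
Proof.
move=> AB [mA decA] [mB decB]; split; first exact: measurableU.
move=> x H fH; have mH := measurable_future_event fH.
have mM := measurable_max_below N x.
rewrite prU// !setIUl prU; first by rewrite decA// decB// !mulrDl.
- by apply: measurableI => //; exact: measurableI.
- by apply: measurableI => //; exact: measurableI.
- apply/seteqP; split => // w [[[Aw _] _] [[Bw _] _]].
  by rewrite -AB.
Qed.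

(** The indicator at time [N + 1] splits an event into two pieces, each of which
    is an event decided at time [N] intersected with the record or with its
    complement.  The induction starts at time [1], where the indicator is
    constant and the only events are the empty and the full one. *)
Lemma decoupled_determined (N : nat) (B : set T) : (0 < N)%N ->
  record_determined Xs N B -> decoupled N B.
Proof.
case: N => // N _; elim: N B => [|N IH] B detB.
  have [->|/set0P[w Bw]] := eqVneq B set0; first exact: decoupled0.
  rewrite (_ : B = setT); first exact: decoupled_start.
  apply/seteqP; split => // w' _; apply: detB Bw => m /andP[m0 m1].
  by have -> : m = 1%N by lia.
pose restr (b : bool) : set T := [set w | exists w',
  [/\ forall m, (0 < m <= N.+1)%N -> complete_record Xs m w = complete_record Xs m w',
      complete_record Xs N.+2 w' = b & B w']].
have detr b : record_determined Xs N.+1 (restr b).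
  move=> w w' agree [v [agree' vb Bv]]; exists v; split => // m mN.
  by rewrite -agree// agree'.
have BE : B = (restr true `&` record N.+2) `|` (restr false `&` ~` record N.+2).
  have restrB w b : restr b w -> complete_record Xs N.+2 w = b -> B w.
    move=> [v [agree vb Bv]] wb; apply: detB Bv => m /andP[m0].
    rewrite leq_eqVlt => /orP[/eqP ->|mN]; first by rewrite vb wb.
    by rewrite agree// m0.
  apply/seteqP; split => w /=.
    by move=> Bw; case E : (complete_record Xs N.+2 w); [left|right]; split => //;
      exists w.
  by move=> [[/restrB rB rw]|[/restrB rB /negP/negbTE rw]]; exact: rB.
rewrite BE; apply: decoupledU.
- by apply/seteqP; split => // w [[_ r] [_ /(_ r)]].
- by have [] := decoupled_record (ltn0Sn N) (IH _ (detr true)).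
- by have [] := decoupled_no_record (ltn0Sn N) (IH _ (detr false)).
Qed.

Lemma pr_no_record (j K : nat) (B : set T) : (0 < j)%N -> (j <= K)%N ->
  record_determined Xs j B ->
  decoupled K (B `&` no_record Xs j K.+1) /\
  pr P (B `&` no_record Xs j K.+1) =
  pr P B * \prod_(j.+1 <= m < K.+1) (1 - m%:R ^- d).
Proof.
move=> j0 jK detB; rewrite -(subnKC jK); elim: (K - j)%N => [|i [decI prI]].
  rewrite addn0 big_geq// mulr1 (_ : no_record _ _ _ = setT) ?setIT.
    by split => //; exact: decoupled_determined.
  by apply/seteqP; split => // w _ m /=; lia.
have gapS : B `&` no_record Xs j (j + i.+1).+1 =
    B `&` no_record Xs j (j + i).+1 `&` ~` record (j + i).+1.
  rewrite addnS; apply/seteqP; split => w /=.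
    move=> [Bw none]; split; first by split => // m jm; apply: none; lia.
    by apply/negP/none; lia.
  move=> [[Bw none] /negP rn]; split => // m /andP[jm].
  rewrite ltnS leq_eqVlt => /orP[/eqP -> //|mi].
  by apply: none; rewrite jm.
have [decI' prI'] := decoupled_no_record (ltn_addr i j0) decI.
rewrite gapS; split; first by rewrite addnS.
by rewrite prI' prI addnS [in RHS]big_nat_recr ?ltnS ?leq_addr//= mulrA.
Qed.

Lemma pr_next_record (j k : nat) (B : set T) : (0 < j)%N -> (j < k)%N ->
  record_determined Xs j B ->
  measurable (B `&` no_record Xs j k `&` record k) /\
  pr P (B `&` no_record Xs j k `&` record k) =
  pr P B * (k%:R ^- d * \prod_(j.+1 <= m < k) (1 - m%:R ^- d)).
Proof.
case: k => // k j0 jk detB.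
have [decI prI] := pr_no_record j0 jk detB.
have [[mR _] prR] := decoupled_record (leq_trans j0 jk) decI.
by split => //; rewrite prR prI -mulrA [X in _ * X]mulrC.
Qed.

Lemma cvg_pr_no_record (j : nat) (B : set T) : (0 < j)%N ->
  record_determined Xs j B ->
  measurable (B `&` [set w | forall k, no_record Xs j k w]) /\
  (fun N => pr P B * \prod_(j.+1 <= m < N) (1 - m%:R ^- d)) @ \oo -->
  pr P (B `&` [set w | forall k, no_record Xs j k w]).
Proof.
move=> j0 detB; pose F i := B `&` no_record Xs j (i + j).+1.
have mF i : measurable (F i).
  by have [[]] := pr_no_record j0 (leq_addl i j) detB.
have FE : B `&` [set w | forall k, no_record Xs j k w] = \bigcap_i F i.
  apply/seteqP; split => w /=; first by move=> [Bw none] i _; split.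
  move=> h; split => [|k m /andP[jm mk]]; first by have [] := h 0%N I.
  by have [_] := h m I; apply; lia.
have mcap : measurable (\bigcap_i F i) by apply: bigcapT_measurable.
rewrite FE; split => //.
have : P \o F @ \oo --> P (\bigcap_i F i).
  apply: nonincreasing_cvg_mu => //.
    by rewrite (le_lt_trans (probability_le1 P (mF 0%N)))// ltry.
  move=> n m nm; apply/subsetPset => w [Bw none]; split => // i /andP[ji iN].
  by apply: none; lia.
rewrite [P (\bigcap_i F i)](prE P mcap) => /fine_cvg cvgF.
rewrite -(cvg_shiftn j.+1); apply: cvg_trans cvgF; apply: near_eq_cvg.
near=> i; rewrite /= addnS.
by have [_ <-] := pr_no_record j0 (leq_addl i j) detB.
Unshelve. all: by end_near. Qed.

(** * Transition probabilities *)

Local Notation arr := (arrival_time Xs).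
Local Notation gap j k := (\prod_(j.+1 <= m < k) (1 - m%:R ^- d : R)).

(** The condition [B] enters through [n] and [j] only: this is the Markov
    property.  It covers both the event that the arrival time is [j] and that
    event refined by all earlier arrival times; the choice [n = j = 1] with the
    full event gives the law of the second record time. *)
Lemma next_arrival_law (n j : nat) (B : set T) : (0 < n)%N -> (0 < j)%N ->
  record_determined Xs j B -> (forall w, B w -> record_count Xs j w = n) ->
  0 < pr P B ->
  [/\ forall k : nat, (j < k)%N ->
        cond_prob P [set w | arr n.+1 w = k%:R%:E] B = k%:R ^- d * gap j k,
      forall k : nat, (k <= j)%N ->
        cond_prob P [set w | arr n.+1 w = k%:R%:E] B = 0 &
      (fun N => gap j N) @ \oo -->
        cond_prob P [set w | arr n.+1 w = +oo%E] B].
Proof.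
move=> n0 j0 detB countB B0; have B_neq0 : pr P B != 0 by rewrite gt_eqF.
split=> [k jk|k kj|].
- rewrite /cond_prob -/(pr P _) -/(pr P B).
  have [_ prE] := pr_next_record j0 jk detB.
  rewrite (_ : _ `&` B = B `&` no_record Xs j k `&` record k).
    by rewrite prE mulrC mulKf.
  apply/seteqP; split => w /=.
    by move=> [/next_arrival_natP h Bw]; have [] := h _ n0 (countB _ Bw).
  by move=> [[Bw none] rk]; split => //; apply/(next_arrival_natP _ n0 (countB _ Bw)).
- rewrite /cond_prob (_ : _ `&` B = set0) ?measure0 ?mul0r//.
  apply/seteqP; split => // w /= [/next_arrival_natP h Bw].
  by have [] := h _ n0 (countB _ Bw); rewrite ltnNge kj.
have [_ cvgB] := cvg_pr_no_record j0 detB.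
rewrite /cond_prob -/(pr P _) -/(pr P B).
rewrite (_ : _ `&` B = B `&` [set w | forall k, no_record Xs j k w]); last first.
  apply/seteqP; split => w /=.
    by move=> [/next_arrival_pinftyP h Bw]; split => //; exact: h n0 (countB _ Bw).
  by move=> [Bw none]; split => //; apply/(next_arrival_pinftyP n0 (countB _ Bw)).
apply: cvg_trans (cvgM cvgB (cvg_cst (pr P B)^-1)); apply: near_eq_cvg.
by apply: nearW => N /=; rewrite mulrC mulKf.
Qed.

Lemma measurable_arrival (n : nat) (s : \bar R) : (2 <= n)%N ->
  measurable [set w | arr n w = s].
Proof.
move=> n2; have [[w ws]|none] := pselect (exists w, arr n w = s); last first.
  rewrite (_ : [set w | _] = set0)//.
  by apply/seteqP; split => // w ws; apply: none; exists w.
have [[winf _]|[k [wk nk _ _]]] := arrival_cases Xs w n2; last first.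
  rewrite -ws wk; have k0 : (0 < k)%N by lia.
  by have [] := decoupled_determined k0 (record_determined_arrival n2).
rewrite -ws winf (_ : [set w | _] =
    \bigcap_k [set w | record_count Xs k w <> n]).
  apply: bigcapT_measurable => k.
  suff /(decoupled_determined (ltn0Sn k))[//] :
    record_determined Xs k.+1 [set w | record_count Xs k w <> n].
  by move=> v v' agree /=; rewrite (agree_record_count agree).
apply/seteqP; split => v /=; first by move=> /(arrival_pinftyP _ _ n2) h k _; exact: h.
by move=> h; apply/(arrival_pinftyP _ _ n2) => k; exact: h.
Qed.

Lemma arrival_in_states (n : nat) (w : T) : (2 <= n)%N ->
  arrival_states R (arr n w).
Proof.
move=> n2; have [[-> _]|[k [-> nk _ _]]] := arrival_cases Xs w n2; first by right.
by left; exists k => //=; exact: leq_trans nk.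
Qed.

Lemma cond_prob_absorbing (n : nat) (B : set T) (s : \bar R) : (2 <= n)%N ->
  measurable B -> (forall w, B w -> arr n w = +oo%E) -> 0 < pr P B ->
  cond_prob P [set w | arr n.+1 w = s] B = (s == +oo%E)%:R.
Proof.
move=> n2 mB Binf B0; rewrite /cond_prob -/(pr P _) -/(pr P B).
have infS w : B w -> arr n.+1 w = +oo%E by move=> /Binf; exact: arrival_pinftyS.
have [->|sinf] := eqVneq s +oo%E.
  rewrite (_ : _ `&` B = B) ?divff ?gt_eqF//.
  by apply/seteqP; split => w /= => [[]//|Bw]; split => //; exact: infS.
rewrite (_ : _ `&` B = set0) ?pr0 ?mul0r//.
apply/seteqP; split => // w /= [ws /infS].
by rewrite ws => /eqP; rewrite (negbTE sinf).
Qed.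

(** If the present state is finite, the past and the present are both events
    decided at that time, so [next_arrival_law] gives them the same conditional
    law; for the next state [+oo] that law is a limit, hence unique.
    From [+oo] the chain cannot move. *)
Lemma arrival_markov : markov_chain P 2 (arrival_states R) arr.
Proof.
split.
- pose f (o : option nat) : \bar R := if o is Some m then m%:R%:E else +oo%E.
  apply: (@sub_countable _ _ _ (f @` setT)).
    apply: subset_card_le => s [[m _ <-]|->]; first by exists (Some m).
    by exists None.
  exact: sub_countable (card_image_le f setT) (countableP _).
- by move=> n w; exact: arrival_in_states.
- by move=> n s n2 _; exact: measurable_arrival.
move=> n s s' n2 Ss' past past0.
have mpast : measurable past.
  rewrite (_ : past = \bigcap_(i in [set i | (2 <= i <= n)%N]) [set w | arr i w = s i]).
    apply: bigcap_measurableType => i /andP[i2 _]; exact: measurable_arrival.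
  by apply/seteqP; split.
have past_n : past `<=` [set w | arr n w = s n].
  by move=> w; apply; rewrite n2 leqnn.
have {}past0 : 0 < pr P past by rewrite -lte_fin -prE.
have now0 : 0 < pr P [set w | arr n w = s n].
  by apply: (lt_le_trans past0); apply: pr_le => //; exact: measurable_arrival.
have [w pw] : past !=set0.
  by apply/set0P; apply: contraTneq past0 => ->; rewrite pr0 ltxx.
have [[winf _]|[k [wk nk _ ck]]] := arrival_cases Xs w n2.
  have sinf : s n = +oo%E by rewrite -winf; apply/esym; exact: past_n.
  rewrite !(@cond_prob_absorbing n)//; first exact: measurable_arrival.
    by move=> v /= ->.
  by move=> v /past_n /= ->.
have sk : s n = k%:R%:E by rewrite -wk; apply/esym; exact: past_n.
have n0 : (0 < n)%N by lia.
have k0 : (0 < k)%N by lia.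
have count_now v : arr n v = s n -> record_count Xs k v = n.
  by rewrite sk => /(arrival_natP _ _ _ n2)[].
have det_now : record_determined Xs k [set v | arr n v = s n].
  by rewrite sk; exact: record_determined_arrival.
have [past_fin past_low past_inf] := next_arrival_law n0 k0
  (record_determined_past n2 sk) (fun v pv => count_now v (past_n v pv)) past0.
have [now_fin now_low now_inf] := next_arrival_law n0 k0 det_now count_now now0.
case: Ss' => [[k' _ <-]|->].
  by have [kk'|k'k] := ltnP k k'; 
    [rewrite past_fin// now_fin | rewrite past_low// now_low].
exact: cvg_unique past_inf now_inf.
Qed.

Lemma gap_gt0 (j k : nat) : (2 <= d)%N -> (0 < j)%N -> 0 < gap j k.
Proof.
move=> d2 j0; rewrite big_seq prodr_gt0// => m; rewrite mem_index_iota => /andP[jm _].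
rewrite subr_gt0 invf_lt1 ?exprn_gt0 ?ltr0n; [|lia|lia].
by rewrite exprn_egt1 ?ltr1n; lia.
Qed.

Lemma cond_prob_gt0 (A B : set T) : measurable A -> measurable B ->
  0 < cond_prob P A B -> 0 < pr P A.
Proof.
move=> mA mB h; rewrite lt_def pr_ge0 andbT; apply/eqP => A0.
have AB0 : pr P (A `&` B) = 0.
  apply/le_anti; rewrite pr_ge0 andbT -A0; apply: pr_le => //.
  exact: measurableI.
by move: h; rewrite /cond_prob -/(pr P _) AB0 mul0r ltxx.
Qed.

Lemma record_determinedT (j : nat) : record_determined Xs j setT.
Proof. by []. Qed.

(** The path along which every record but the second directly follows the
    preceding one has positive probability. *)
Lemma pr_arrival_gt0 (n k : nat) : (2 <= d)%N -> (2 <= n)%N -> (n <= k)%N ->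
  0 < pr P [set w | arr n w = k%:R%:E].
Proof.
move=> d2; have law_gt0 j i : (0 < j)%N -> (0 < i)%N -> 0 < i%:R ^- d * gap j i.
  by move=> j0 i0; rewrite mulr_gt0 ?gap_gt0// invr_gt0 exprn_gt0// ltr0n.
elim: n k => // -[//|n] IH k _ nk; have [n0|n0] := posnP n.
  have prT0 : 0 < pr P setT by rewrite prT.
  have [law _ _] := @next_arrival_law 1 1 setT erefl erefl (@record_determinedT 1)
    (fun w _ => record_count1 Xs w) prT0.
  rewrite n0 in nk *; apply: (@cond_prob_gt0 _ setT); [exact: measurable_arrival|by []|].
  by rewrite law//; apply: law_gt0 => //; lia.
have n2 : (2 <= n.+1)%N by lia.
have k1 : (n.+1 <= k.-1)%N by lia.
have k10 : (0 < k.-1)%N by lia.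
have countB w : arr n.+1 w = k.-1%:R%:E -> record_count Xs k.-1 w = n.+1.
  by move=> /(arrival_natP _ _ _ n2)[].
have [law _ _] := next_arrival_law (ltn0Sn n) k10
  (record_determined_arrival n2) countB (IH k.-1 n2 k1).
apply: (@cond_prob_gt0 _ [set w | arr n.+1 w = k.-1%:R%:E]).
- exact: measurable_arrival.
- exact: measurable_arrival.
by rewrite law; [apply: law_gt0 => //; lia|lia].
Qed.

(** For [d = 2] this is an equality: the product of the
    [1 - m ^- 2 = (m - 1) * (m + 1) / m ^+ 2] telescopes. *)
Lemma gap1_ge (N : nat) : (2 <= d)%N ->
  N.+2%:R / (2 * N.+1%:R) <= gap 1 N.+2.
Proof.
move=> d2; elim: N => [|N IH]; first by rewrite big_geq// mulr1 divff.
rewrite big_nat_recr//=.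
have le_d : N.+2%:R ^- d <= N.+2%:R ^- 2 :> R.
  rewrite lef_pV2 ?posrE ?exprn_gt0 ?ltr0n//.
  by rewrite ler_weXn2l// ler1n.
have N0 : 0 <= N%:R :> R by rewrite ler0n.
apply: (@le_trans _ _ (N.+2%:R / (2 * N.+1%:R) * (1 - N.+2%:R ^- 2))).
  rewrite le_eqVlt; apply/orP; left; apply/eqP.
  by rewrite -!natr1; field; rewrite !gt_eqF//; lra.
apply: ler_pM => //; last by rewrite lerB.
by rewrite subr_ge0 invf_le1 ?exprn_gt0 ?ltr0n// exprn_ege1// ler1n.
Qed.

(** With positive probability there is no record after the first vector. *)
Lemma pr_arrival_pinfty_gt0 (n : nat) : (2 <= d)%N -> (2 <= n)%N ->
  0 < pr P [set w | arr n w = +oo%E].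
Proof.
move=> d2 n2; have prT0 : 0 < pr P setT by rewrite prT.
have [_ _ law] := @next_arrival_law 1 1 setT erefl erefl (@record_determinedT 1)
  (fun w _ => record_count1 Xs w) prT0.
have half : 2^-1 <= cond_prob P [set w | arr 2 w = +oo%E] setT.
  rewrite -(cvg_lim _ law)//; apply: limr_ge; first by apply/cvg_ex; eexists; exact: law.
  near=> N; have N2 : (2 <= N)%N by near: N; exact: nbhs_infty_ge.
  have NE : N = N.-2.+2 by lia.
  rewrite NE; apply: le_trans (gap1_ge N.-2 d2).
  rewrite ler_pdivlMr ?mulr_gt0 ?ltr0n// mulrA mulVf// mul1r ler_nat.
  by lia.
have prinf2 : 0 < pr P [set w | arr 2 w = +oo%E].
  apply: (@cond_prob_gt0 _ setT) => //; first exact: measurable_arrival.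
  by apply: lt_le_trans half; rewrite invr_gt0.
apply: (lt_le_trans prinf2); apply: pr_le; [exact: measurable_arrival..|].
rewrite -(subnKC n2); elim: (n - 2)%N => [|i IH]; first by rewrite addn0.
rewrite addnS; apply: (subset_trans IH) => w; apply: arrival_pinftyS.
by rewrite leq_addr.
Unshelve. all: by end_near. Qed.

End CompleteRecordLaw.

Theorem proposition3p3
    (R : realType) (d : nat) (disp disp0 : measure_display)
    (T : measurableType disp) (P : probability T R)
    (T0 : measurableType disp0) (P0 : probability T0 R)
    (X0 : {RV P0 >-> d.-tuple R}) (X : nat -> {RV P >-> d.-tuple R}) :
  (2 <= d)%N ->
  independent_components X0 ->
  continuous_marginals X0 ->
  independent_copies X X0 ->
  let arr : nat -> T -> \bar R := arrival_time (fun m => X m) in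
  [/\ markov_chain P 2 (arrival_states R) arr,
      forall n j : nat, (3 <= n)%N -> (n.-1 <= j)%N ->
        [/\ forall k : nat, k = j.+1 ->
              cond_prob P [set w | arr n w = k%:R%:E]
                          [set w | arr n.-1 w = j%:R%:E] = k%:R ^- d,
            forall k : nat, (j.+1 < k)%N ->
              cond_prob P [set w | arr n w = k%:R%:E]
                          [set w | arr n.-1 w = j%:R%:E] =
              k%:R ^- d * \prod_(j.+1 <= m < k) (1 - m%:R ^- d) &
            (fun N : nat => \prod_(j.+1 <= m < N) (1 - m%:R ^- d : R)) @ \oo
              --> cond_prob P [set w | arr n w = +oo%E]
                              [set w | arr n.-1 w = j%:R%:E]] &
      forall n : nat, (3 <= n)%N ->
        cond_prob P [set w | arr n w = +oo%E] [set w | arr n.-1 w = +oo%E] = 1].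
Proof.
move=> d2 indep cont copies arr; split.
- exact: (arrival_markov indep cont copies).
- move=> [|[|n]]// j n2 nj; have {}n2 : (2 <= n.+1)%N by [].
  have j0 : (0 < j)%N by lia.
  have count_j w : arr n.+1 w = j%:R%:E ->
      record_count (fun m => X m) j w = n.+1.
    by move=> /(arrival_natP _ _ _ n2)[].
  have [law _ law_inf] := next_arrival_law indep cont copies (ltn0Sn n) j0
    (record_determined_arrival n2) count_j
    (pr_arrival_gt0 indep cont copies d2 n2 nj).
  split=> [k ->|k jk|]; last exact: law_inf.
    by rewrite law// big_geq// mulr1.
  by rewrite law// (ltn_trans (ltnSn j)).
- move=> [|[|n]]// n2; have {}n2 : (2 <= n.+1)%N by [].
  rewrite (cond_prob_absorbing (n := n.+1)) ?eqxx//.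
    exact: (measurable_arrival indep cont copies).
  exact: (pr_arrival_pinfty_gt0 indep cont copies).
Qed.
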